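(* Let $Q,Q'$ be two non-zero monomial primary ideals of $S=K[x_1,\ldots,x_n]$ with different associated prime ideals. Suppose that $\dim(S/(Q+Q'))=0$. Then $$\operatorname{sdepth}_S(S/(Q\cap Q'))\leq \max\left\{\min\left\{\dim(S/Q'),\left\lceil\frac{\dim(S/Q)}{2}\right\rceil\right\},\ \min\left\{\dim(S/Q),\left\lceil\frac{\dim(S/Q')}{2}\right\rceil\right\}\right\}.$$
   Context: $K$ is a field and $S=K[x_1,\ldots,x_n]$ with its standard $\mathbb{Z}^n$-grading (multigrading). For a finitely generated multigraded $S$-module $M$, a homogeneous element $z\in M$ and $Z\subseteq\{x_1,\ldots,x_n\}$, let $zK[Z]\subset M$ be the $K$-subspace of all elements $zf$, $f\in K[Z]$; it is called a Stanley space of dimension $|Z|$ if it is a free $K[Z]$-module. A Stanley decomposition of $M$ is a presentation of the $K$-vector space $M$ as a finite direct sum of Stanley spaces $\mathcal{D}: M=\bigoplus_{i=1}^r z_iK[Z_i]$. Set $\operatorname{sdepth}\mathcal{D}=\min\{|Z_i|: i=1,\ldots,r\}$, and $\operatorname{sdepth}_S(M)=\operatorname{sdepth}(M)=\max\{\operatorname{sdepth}\mathcal{D}:\mathcal{D}\text{ a Stanley decomposition of }M\}$ (the Stanley depth of $M$). $\lceil a\rceil$ is the smallest integer $\geq a$.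
   Formalization: The formal statement also assumes that neither of Q, Q' contains the other; without this the claim fails, e.g. for Q=(x,y), Q'=(x) in K[x,y], where the Stanley depth is 1 and the bound is 0. *)

(* Defs.v *)
From HB Require Import structures.
From mathcomp Require Import all_boot all_order all_algebra.
From mathcomp Require Import generic_quotient ring_quotient.
From mathcomp Require Import boolp.
From mathcomp Require Import mpoly.

Set Implicit Arguments.
Unset Strict Implicit.
Unset Printing Implicit Defensive.

Import GRing.Theory.

Local Open Scope ring_scope.
Local Open Scope quotient_scope.

Section CommutativeAlgebra.
Variable R : comNzRingType.

(* An [idealr] is proper by definition, as a primary ideal must be.  It is a
   boolean predicate, which is no restriction in the presence of the classical
   axioms of [boolp]. *)
Definition primary_ideal (I : idealr R) : Prop :=
  forall a b : R, a * b \in I -> a \in I \/ exists k : nat, b ^+ k \in I.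

Definition associated_prime (M : lmodType R) (P : prime_idealr R) : Prop :=
  exists x : M, forall f : R, f \in P <-> f *: x = 0.

(* p_0 < p_1 < ... < p_d : the length counts the strict inclusions. *)
Definition has_prime_chain (d : nat) : Prop :=
  exists p : 'I_d.+1 -> prime_idealr R,
    forall i j : 'I_d.+1, (i < j)%N ->
      {subset p i <= p j} /\ ~ {subset p j <= p i}.

(* "The Krull dimension of R is the natural number d"; it is a relation since
   the dimension of a general ring may be infinite. *)
Definition krull_dim (d : nat) : Prop :=
  has_prime_chain d /\ forall e : nat, has_prime_chain e -> (e <= d)%N.

End CommutativeAlgebra.

Arguments krull_dim R d : clear implicits.
Arguments associated_prime {R} M P.

Section QuotientModule.
Variables (R : comNzRingType) (I : idealr R).
Local Notation Q := {ideal_quot I}.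

Definition quot_scale (a : R) (x : Q) : Q := \pi_Q a * x.

Lemma quot_scaleA a b x : quot_scale a (quot_scale b x) = quot_scale (a * b) x.
Proof. by rewrite /quot_scale rmorphM mulrA. Qed.

Lemma quot_scale1 : left_id 1 quot_scale.
Proof. by move=> x; rewrite /quot_scale rmorph1 mul1r. Qed.

Lemma quot_scaleDr : right_distributive quot_scale +%R.
Proof. by move=> a x y; rewrite /quot_scale mulrDr. Qed.

Lemma quot_scaleDl x : {morph quot_scale^~ x : a b / a + b}.
Proof. by move=> a b; rewrite /quot_scale rmorphD mulrDl. Qed.

HB.instance Definition _ := GRing.Zmodule_isLmodule.Build R Q
  quot_scaleA quot_scale1 quot_scaleDr quot_scaleDl.

End QuotientModule.

Definition generated_by_monomials (K : fieldType) (n : nat)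
    (I : {pred {mpoly K[n]}}) : Prop :=
  exists G : 'X_{1..n} -> Prop, forall f : {mpoly K[n]},
    f \in I <-> exists s : seq ({mpoly K[n]} * 'X_{1..n}),
      (forall t, t \in s -> G t.2) /\ f = \sum_(t <- s) t.1 * 'X_[t.2].

HB.mixin Record isMonomial (K : fieldType) (n : nat)
    (S : {mpoly K[n]} -> bool) := {
  monomial_subproof : generated_by_monomials S
}.

(* Proper monomial ideals of K[x_1, ..., x_n]. *)
#[short(type="monomial_ideal")]
HB.structure Definition MonomialIdeal (K : fieldType) (n : nat) :=
  {S of Idealr {mpoly K[n]} S & isMonomial K n S}.

Section MonomialIdealTheory.
Variables (K : fieldType) (n : nat).
Local Notation S := {mpoly K[n]}.

Lemma monomial_msupp (I : monomial_ideal K n) (f : S) (m : 'X_{1..n}) :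
  f \in (I : {pred S}) -> m \in msupp f -> 'X_[m] \in (I : {pred S}).
Proof.
have [G HG] := @monomial_subproof K n I => /HG [s [sG ->]] ms.
have : exists2 t, t \in s & m \in msupp (t.1 * 'X_[t.2]).
  move: ms; elim: s {sG} => [|t s IHs]; first by rewrite big_nil msupp0.
  rewrite big_cons => /msuppD_le; rewrite mem_cat => /orP[h|/IHs [u us hu]].
    by exists t => //; rewrite inE eqxx.
  by exists u => //; rewrite inE us orbT.
case=> t ts; rewrite (perm_mem (msuppMX _ _)) => /mapP[m' _ ->].
rewrite mpolyXD mulrC; apply: idealMr; apply/HG; exists [:: (1, t.2)].
split; first by move=> u; rewrite inE => /eqP -> /=; exact: sG.
by rewrite big_seq1 /= mul1r.
Qed.

Lemma monomialI (I : idealr S) :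
  (forall f m, f \in (I : {pred S}) -> m \in msupp f -> 'X_[m] \in (I : {pred S})) ->
  generated_by_monomials (I : {pred S}).
Proof.
move=> H; exists (fun m => 'X_[m] \in (I : {pred S})) => f; split.
  move=> fI; exists [seq (f@_m *: 1, m) | m <- msupp f]; split.
    by move=> _ /mapP[m ms ->] /=; exact: H fI ms.
  rewrite big_map {1}[f]mpolyE; apply: eq_bigr => m _ /=.
  by rewrite -scalerAl mul1r.
case=> s [sG ->]; rewrite big_seq; apply: rpred_sum => t ts.
by rewrite idealMr // sG.
Qed.

End MonomialIdealTheory.

Section SumAndIntersection.
Variables (K : fieldType) (n : nat) (I J : monomial_ideal K n).
Local Notation S := {mpoly K[n]}.

Definition cap_pred (f : S) : bool := (f \in I) && (f \in J).

Lemma ideal_capE f : (f \in cap_pred) = (f \in I) && (f \in J).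
Proof. by []. Qed.

Lemma ideal_cap_closed : idealr_closed cap_pred.
Proof.
split; rewrite ?ideal_capE ?rpred0 ?idealr1 // => a u v.
rewrite !ideal_capE => /andP[uI uJ] /andP[vI vJ].
by rewrite !rpredD ?idealMr.
Qed.

HB.instance Definition _ := isIdealr.Build S cap_pred ideal_cap_closed.

Lemma ideal_cap_monomial : generated_by_monomials cap_pred.
Proof.
apply: (@monomialI K n cap_pred) => f m; rewrite !ideal_capE => /andP[fI fJ] mf.
by rewrite (monomial_msupp fI mf) (monomial_msupp fJ mf).
Qed.

HB.instance Definition _ := isMonomial.Build K n cap_pred ideal_cap_monomial.

Definition sum_pred (f : S) : bool :=
  `[< exists g h : S, [/\ g \in I, h \in J & f = g + h] >].

Lemma ideal_sumP f :
  reflect (exists g h : S, [/\ g \in I, h \in J & f = g + h]) (f \in sum_pred).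
Proof. by apply: (iffP idP) => [/asboolP|H]; last apply/asboolP. Qed.

Lemma ideal_sum_closed : idealr_closed sum_pred.
Proof.
split.
- by apply/ideal_sumP; exists 0, 0; rewrite !rpred0 addr0.
- apply/negP => /ideal_sumP [g [h [gI hJ E]]].
  have : 0%MM \in msupp (g + h) by rewrite -E msupp1 inE.
  move=> /msuppD_le; rewrite mem_cat => /orP[] m0.
    by have := monomial_msupp gI m0; rewrite mpolyX0 idealr1.
  by have := monomial_msupp hJ m0; rewrite mpolyX0 idealr1.
- move=> a u v /ideal_sumP[g [h [gI hJ ->]]] /ideal_sumP[g' [h' [gI' hJ' ->]]].
  apply/ideal_sumP; exists (a * g + g'), (a * h + h').
  by split; rewrite ?rpredD ?idealMr // mulrDr addrACA.
Qed.

HB.instance Definition _ := isIdealr.Build S sum_pred ideal_sum_closed.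

Lemma ideal_sum_monomial : generated_by_monomials sum_pred.
Proof.
apply: (@monomialI K n sum_pred) => f m /ideal_sumP[g [h [gI hJ ->]]].
move=> /msuppD_le; rewrite mem_cat => /orP[] ms; apply/ideal_sumP.
  by exists 'X_[m], 0; rewrite rpred0 addr0 (monomial_msupp gI ms).
by exists 0, 'X_[m]; rewrite rpred0 add0r (monomial_msupp hJ ms).
Qed.

HB.instance Definition _ := isMonomial.Build K n sum_pred ideal_sum_monomial.

Definition ideal_cap : monomial_ideal K n := cap_pred.
Definition ideal_sum : monomial_ideal K n := sum_pred.

End SumAndIntersection.

(* A Z^n-graded module over K[x_1, ..., x_n]: M is the direct sum of the
   K-subspaces [piece a], and x_i maps [piece a] into [piece (a + e_i)]. *)
HB.mixin Record isMultigraded (K : fieldType) (n : nat) M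
    of GRing.Lmodule {mpoly K[n]} M := {
  piece : 'rV[int]_n -> M -> Prop;
  piece0 : forall a, piece a 0;
  pieceP : forall a (c : K) (x y : M),
    piece a x -> piece a y -> piece a (c%:MP *: x + y);
  pieceX : forall a (i : 'I_n) (x : M),
    piece a x -> piece (a + delta_mx 0 i) ('X_i *: x);
  piece_span : forall x : M, exists (s : seq 'rV[int]_n) (c : 'rV[int]_n -> M),
    (forall a, piece a (c a)) /\ x = \sum_(a <- s) c a;
  piece_direct : forall (s : seq 'rV[int]_n) (c : 'rV[int]_n -> M),
    uniq s -> (forall a, piece a (c a)) -> \sum_(a <- s) c a = 0 ->
    forall a, a \in s -> c a = 0
}.

#[short(type="multigradedType")]
HB.structure Definition Multigraded (K : fieldType) (n : nat) :=
  {M of GRing.Lmodule {mpoly K[n]} M & isMultigraded K n M}.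

(* The multidegree of a monomial, as an element of Z^n. *)
Definition mdegree (n : nat) (m : 'X_{1..n}) : 'rV[int]_n :=
  \row_(i < n) (m i)%:Z.

Section QuotientGrading.
Variables (K : fieldType) (n : nat) (I : monomial_ideal K n).
Local Notation S := {mpoly K[n]}.
Local Notation Q := {ideal_quot I}.

Definition quot_piece (a : 'rV[int]_n) (x : Q) : Prop :=
  exists f : S, (forall m, m \in msupp f -> mdegree m = a) /\ x = \pi_Q f.

Lemma mdegree_inj : injective (@mdegree n).
Proof.
move=> m m' /rowP E; apply/mnmP => i; have := E i.
by rewrite !mxE => -[].
Qed.

Lemma quot_scaleE (f g : S) : f *: \pi_Q g = \pi_Q (f * g).
Proof. by rewrite rmorphM. Qed.

Lemma pi_eq0 (f : S) : (\pi_Q f == 0) = (f \in (I : {pred S})).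
Proof. by rewrite -(rmorph0 (\pi_Q)) -Quotient.idealrBE subr0. Qed.

Lemma quot_piece0 a : quot_piece a 0.
Proof. by exists 0; rewrite rmorph0; split=> // m; rewrite msupp0. Qed.

Lemma quot_pieceP a (c : K) (x y : Q) :
  quot_piece a x -> quot_piece a y -> quot_piece a (c%:MP *: x + y).
Proof.
move=> [f [fa ->]] [g [ga ->]]; exists (c *: f + g).
rewrite quot_scaleE -rmorphD mul_mpolyC; split=> // m.
by move=> /msuppD_le; rewrite mem_cat => /orP[/msuppZ_le/fa|/ga].
Qed.

Lemma quot_pieceX a (i : 'I_n) (x : Q) :
  quot_piece a x -> quot_piece (a + delta_mx 0 i) ('X_i *: x).
Proof.
move=> [f [fa ->]]; exists ('X_i * f); rewrite quot_scaleE; split=> // m.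
rewrite mulrC (perm_mem (msuppMX _ _)) => /mapP[m' /fa <- ->].
apply/rowP => j; rewrite !mxE mnmDE mnm1E eqxx eq_sym /=.
by rewrite addnC PoszD; case: (j == i).
Qed.

Lemma quot_piece_span (x : Q) :
  exists (s : seq 'rV[int]_n) (c : 'rV[int]_n -> Q),
    (forall a, quot_piece a (c a)) /\ x = \sum_(a <- s) c a.
Proof.
pose f := repr x.
pose h a := \sum_(m <- msupp f | mdegree m == a) f@_m *: 'X_[m].
exists [seq mdegree m | m <- msupp f], (fun a => \pi_Q (h a)); split.
  move=> a; exists (h a); split=> // m.
  rewrite /h; elim: (msupp f) => [|m' s IHs]; first by rewrite big_nil msupp0.
  rewrite big_cons; case: eqP => [Em' /msuppD_le|_ //].
  by rewrite mem_cat => /orP[/msuppZ_le|//]; rewrite msuppX inE => /eqP ->.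
rewrite -[x]reprK -/f big_map -rmorph_sum; congr (\pi_Q _).
rewrite {1}[f]mpolyE; apply: eq_big_seq => m mf.
rewrite /h (big_rem m) //= eqxx big1_seq ?addr0 // => m' /andP[/eqP/mdegree_inj ->].
by rewrite mem_rem_uniqF ?msupp_uniq.
Qed.

Lemma quot_piece_direct (s : seq 'rV[int]_n) (c : 'rV[int]_n -> Q) :
  uniq s -> (forall a, quot_piece a (c a)) -> \sum_(a <- s) c a = 0 ->
  forall a, a \in s -> c a = 0.
Proof.
move=> us /choice [h hP] sum0 a as_.
have hc b : c b = \pi_Q (h b) by case: (hP b).
have hI : \sum_(b <- s) h b \in (I : {pred S}).
  rewrite -pi_eq0 rmorph_sum; apply/eqP; rewrite -[RHS]sum0.
  by apply: eq_bigr => b _; rewrite hc.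
rewrite hc; apply/eqP; rewrite pi_eq0 [h a]mpolyE big_seq; apply: rpred_sum => m mh.
rewrite -mul_mpolyC idealMr //; apply: monomial_msupp hI _.
rewrite mcoeff_msupp raddf_sum /= (bigD1_seq a) //= big1 ?addr0.
  by rewrite -mcoeff_msupp.
move=> b ba; apply: memN_msupp_eq0; apply/negP => mb.
by case/eqP: ba; rewrite -((hP b).1 _ mb) ((hP a).1 _ mh).
Qed.

HB.instance Definition _ := isMultigraded.Build K n Q
  quot_piece0 quot_pieceP quot_pieceX quot_piece_span quot_piece_direct.

End QuotientGrading.

Section StanleyDepth.
Variables (K : fieldType) (n : nat).
Local Notation S := {mpoly K[n]}.

Definition homogeneous (M : multigradedType K n) (z : M) : Prop :=
  exists a : 'rV[int]_n, piece a z.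

(* The subring K[Z] of K[x_1, ..., x_n]. *)
Definition polys_in (Z : {set 'I_n}) : {pred S} :=
  [pred f : S | all (fun m : 'X_{1..n} =>
                       [forall i, (0 < m i)%N ==> (i \in Z)]) (msupp f)].

Definition stanley_space (M : multigradedType K n) (z : M) (Z : {set 'I_n})
    (x : M) : Prop :=
  exists2 f : S, f \in polys_in Z & x = f *: z.

(* z K[Z] is free over K[Z], with basis z. *)
Definition free_over (M : multigradedType K n) (z : M) (Z : {set 'I_n}) : Prop :=
  forall f : S, f \in polys_in Z -> f *: z = 0 -> f = 0.

Record stanley_decomposition (M : multigradedType K n) := StanleyDecomposition {
  sd_size : nat;
  sd_elt : 'I_sd_size -> M;
  sd_vars : 'I_sd_size -> {set 'I_n};
  sd_homogeneous : forall i, homogeneous (sd_elt i);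
  sd_free : forall i, free_over (sd_elt i) (sd_vars i);
  sd_direct : forall x : M, exists! u : {ffun 'I_sd_size -> M},
    (forall i, stanley_space (sd_elt i) (sd_vars i) (u i)) /\ x = \sum_i u i
}.

(* As #|Z_i| <= n, the default value n only matters for the empty
   decomposition of the zero module. *)
Definition sdepth_decomposition (M : multigradedType K n)
    (D : stanley_decomposition M) : nat :=
  \big[minn/n]_(i < sd_size D) #|sd_vars i|.

(* The decompositions have sdepth at most n, and a finitely generated M has at
   least one, so that this is a genuine maximum. *)
Definition sdepth (M : multigradedType K n) : nat :=
  \max_(d < n.+1 |
     `[< exists D : stanley_decomposition M, sdepth_decomposition D = d >]) d.

End StanleyDepth.

Arguments sdepth {K n} M.

(* Main.v *)
Require Import Defs.
From HB Require Import structures.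
From mathcomp Require Import all_boot all_order all_algebra.
From mathcomp Require Import generic_quotient ring_quotient.
From mathcomp Require Import boolp.
From mathcomp Require Import mpoly.

Set Implicit Arguments.
Unset Strict Implicit.
Unset Printing Implicit Defensive.

Import GRing.Theory.

Local Open Scope ring_scope.

(** A monomial primary ideal [I] is described by the set [free_vars I] of the
    variables none of whose powers lies in [I]: its radical is generated by the
    other variables, and the dimension of the quotient by [I] is the number of
    free variables.  Write [X] and [Y] for the free variables of [Q] and [Q'].
    Chains of monomial primes show that [#|X| <= d] and [#|Y| <= d']
    ([krull_dim_ge_card]), and that [X] and [Y] are disjoint, since [Q + Q'] has
    a zero-dimensional quotient ([free_vars_disjoint]).

    As each multigraded piece of the quotient by a monomial ideal is at most a
    line, a Stanley decomposition of it is a partition of the monomials outside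
    the ideal into blocks [g_i * (monomials in Z_i)] ([stanley_partition]).  Take
    such a partition for [Q :&: Q'], with all [#|Z_i| >= s].

    - A monomial [m] of [Q'] outside [Q] lies in some block, and [m * x_j ^ k]
      stays outside [Q :&: Q'], hence outside [Q], for [x_j] in [Z_i]; so
      [Z_i] is contained in [X], and [s <= #|X|].  Symmetrically [s <= #|Y|].
    - The block of the monomial 1 has [Z_i] contained in [X] or in [Y], because
      a high power of a variable outside [X] times a high power of a variable
      outside [Y] lies in [Q :&: Q'] ([block_of_one]).
    - If it is contained in [X], then [s <= uphalf #|Y|] ([partition_uphalf]).
      Fix a large [N].  For [x_j] in [Y] the monomial [x_j ^ N] is in [Q], so no
      variable of its block has a power in [Q']: they all belong to [Y].  This
      is then not the block of 1, its generator is a power [x_j ^ c] with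
      [c > 0], and distinct [j] give distinct blocks.  Draw an arrow from [j] to
      each other variable [k] of the block of [x_j ^ N]: this block then contains
      [x_j ^ N * x_k ^ N], so two opposite arrows would make two distinct blocks
      meet.  An oriented graph on [Y] with all out-degrees at least [s - 1] has
      [2 (s - 1) < #|Y|] ([oriented_graph_outdegree]).

    In the first case of the last alternative [s <= minn d (uphalf d')], in the
    second one [s <= minn d' (uphalf d)]. *)

(** * Out-degrees in oriented graphs *)

(** Double counting: the average out-degree is the number of arrows over the
    number of vertices, and each pair of vertices carries at most one arrow. *)
Lemma oriented_graph_outdegree (T : finType) (Y : {set T}) (r : rel T) (s : nat) :
  irreflexive r -> {in Y &, forall j k, r j k -> ~~ r k j} ->
  {in Y, forall j, (s <= #|[set k in Y | r j k]|)%N} ->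
  (0 < #|Y|)%N -> (s.*2 < #|Y|)%N.
Proof.
move=> rirr rasym rdeg Y0.
have outE j : #|[set k in Y | r j k]| = (\sum_(k in Y) r j k)%N.
  by rewrite -sum1dep_card big_mkcondr.
pose out := (\sum_(j in Y) \sum_(k in Y) r j k)%N.
have lo : (#|Y| * s <= out)%N.
  by rewrite -sum_nat_const; apply: leq_sum => j jY; rewrite -outE rdeg.
have hi : (out.*2 <= #|Y| * #|Y|.-1)%N.
  rewrite -addnn {1}/out exchange_big -big_split -sum_nat_const.
  apply: leq_sum => j jY /=; rewrite -big_split /=.
  rewrite (bigD1 j) //= rirr /= (cardsD1 j) jY -sum1_card.
  rewrite (eq_bigl (mem (Y :\ j))); last by move=> k; rewrite !inE andbC.
  apply: leq_sum => k; rewrite !inE => /andP[_ kY].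
  have := rasym j k jY kY; case: (r j k) => [/(_ isT)/negPf->|_] //=.
  by case: (r k j).
have : (#|Y| * s.*2 <= #|Y| * #|Y|.-1)%N.
  by apply: leq_trans hi; rewrite -doubleMr leq_double.
by rewrite leq_pmul2l // -ltnS prednK.
Qed.

(** * Primes of a quotient ring *)

Section PrimesOfQuotient.
Local Open Scope quotient_scope.

(** The kernel of the morphism that [f] induces on the quotient is prime because
    [D] is a domain; testing [f] on a representative spares its construction. *)
Lemma quotient_kernel_prime (R : comNzRingType) (I : idealr R) (D : idomainType)
    (f : {rmorphism R -> D}) :
  (forall a, a \in I -> f a = 0) ->
  exists P : prime_idealr {ideal_quot I},
    forall a, (\pi_{ideal_quot I} a \in P) = (f a == 0).
Proof.
move=> fI; pose S (x : {ideal_quot I}) : bool := f (repr x) == 0.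
have SE a : S (\pi_{ideal_quot I} a) = (f a == 0).
  rewrite /S; congr (_ == 0); apply/eqP; rewrite -subr_eq0 -rmorphB /=.
  by apply/eqP/fI; rewrite Quotient.idealrBE reprK.
have Sideal : idealr_closed (S : {pred {ideal_quot I}}).
  split.
  - change (is_true (S 0)).
    by rewrite -(rmorph0 (\pi_{ideal_quot I})) SE rmorph0.
  - change (is_true (~~ S 1)).
    by rewrite -(rmorph1 (\pi_{ideal_quot I})) SE rmorph1 oner_eq0.
  - move=> a u v; change (S u -> S v -> S (a * u + v)).
    rewrite -[a]reprK -[u]reprK -[v]reprK -rmorphM -rmorphD !SE.
    by rewrite rmorphD rmorphM => /eqP -> /eqP ->; rewrite mulr0 addr0.
have Sprime : prime_idealr_closed (S : {pred {ideal_quot I}}).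
  move=> u v; change (S (u * v) -> S u || S v); rewrite -[u]reprK -[v]reprK.
  by rewrite -rmorphM !SE rmorphM mulf_eq0.
pose P : prime_idealr {ideal_quot I} := HB.pack S
  (isIdealr.Build {ideal_quot I} S Sideal)
  (isPrimeIdealrClosed.Build {ideal_quot I} S Sprime).
by exists P => a; rewrite -SE.
Qed.

End PrimesOfQuotient.

(** * Monomial ideals and dimension *)

Section MonomialIdeals.
Local Open Scope quotient_scope.
Variables (K : fieldType) (n : nat).
Local Notation S := {mpoly K[n]}.
Implicit Types (m w : 'X_{1..n}) (V Z : {set 'I_n}) (I J : monomial_ideal K n).

Definition supp_in Z m : bool := [forall i, (0 < m i)%N ==> (i \in Z)].

Lemma supp_inD Z w j k : supp_in Z w -> j \in Z -> supp_in Z (w + U_(j) *+ k)%MM.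
Proof.
move=> /forallP wZ jZ; apply/forallP => l; rewrite mnmDE mulmnE mnm1E.
case: eqP => [<-|_]; first by rewrite jZ implybT.
by rewrite mul0n addn0 wZ.
Qed.

(** The retraction onto the polynomial ring in the variables of [V]; its kernel
    is the monomial prime generated by the variables outside [V]. *)
Definition restrict V : S -> S :=
  comp_mpoly [tuple if i \in V then 'X_i else 0 | i < n].

HB.instance Definition _ V := GRing.LRMorphism.copy (restrict V)
  (comp_mpoly [tuple if i \in V then 'X_i else 0 | i < n]).

Lemma restrictX V m : restrict V 'X_[m] = if supp_in V m then 'X_[m] else 0.
Proof.
rewrite /restrict comp_mpolyX; case: ifPn => [/forallP mV|].
  rewrite mpolyXE_id; apply: eq_bigr => i _; rewrite tnth_mktuple.
  by have := mV i; case: posnP => [-> _|_ /= ->//]; rewrite !expr0.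
rewrite negb_forall => /existsP[i]; rewrite negb_imply => /andP[mi iV].
by rewrite (bigD1 i) //= tnth_mktuple (negPf iV) expr0n eqn0Ngt mi mul0r.
Qed.

Lemma restrict_eq0 V (f : S) :
  (forall m, m \in msupp f -> ~~ supp_in V m) -> restrict V f = 0.
Proof.
move=> fV; rewrite [f]mpolyE linear_sum big_seq big1 // => m mf.
by rewrite linearZ /= restrictX (negPf (fV m mf)) scaler0.
Qed.

Lemma supp_inS V Z m : V \subset Z -> supp_in V m -> supp_in Z m.
Proof.
move=> /subsetP VZ /forallP mV; apply/forallP => i; apply/implyP => mi.
by apply: VZ; move: (mV i); rewrite mi.
Qed.

Lemma restrict_restrict V Z (f : S) :
  V \subset Z -> restrict V (restrict Z f) = restrict V f.
Proof.
move=> VZ; rewrite [f]mpolyE (linear_sum (restrict Z)) !(linear_sum (restrict V)).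
apply: eq_bigr => m _ /=; rewrite !linearZ /= !restrictX.
case: (boolP (supp_in Z m)) => [_|mZ]; first by rewrite restrictX.
rewrite rmorph0; case: ifPn => // /(supp_inS VZ) mZ'.
by rewrite mZ' in mZ.
Qed.

(** When [I] lies in the prime generated by the variables outside [Z], adding
    the variables of [Z] one at a time to this prime gives a chain of [#|Z|]
    strict inclusions of primes containing [I]. *)
Lemma krull_dim_ge_card I Z d :
  (forall m, 'X_[m] \in I -> ~~ supp_in Z m) ->
  krull_dim {ideal_quot I} d -> (#|Z| <= d)%N.
Proof.
move=> IZ [_ dmax]; apply: dmax.
(* The variables that survive modulo the k-th prime of the chain. *)
pose V k := [set i in drop k (enum Z)].
have VZ k : V k \subset Z.
  by apply/subsetP => i; rewrite inE => /mem_drop; rewrite mem_enum.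
have VI k (f : S) : f \in I -> restrict (V k) f = 0.
  move=> fI; apply: restrict_eq0 => m mf.
  apply: contra (IZ _ (monomial_msupp fI mf)); exact: supp_inS.
have /choice[p pE] (k : 'I_#|Z|.+1) : exists P : prime_idealr {ideal_quot I},
    forall a, (\pi_{ideal_quot I} a \in P) = (restrict (V k) a == 0).
  exact/quotient_kernel_prime/VI.
exists p => i j ij; split.
  move=> x; rewrite -[x]reprK !pE => /eqP xi.
  rewrite -(@restrict_restrict _ (V i)) ?xi ?rmorph0 //.
  apply/subsetP => v; rewrite !inE -(subnK (ltnW ij)) -drop_drop.
  exact: mem_drop.
have iZ : (i < size (enum Z))%N by rewrite -cardE (leq_trans ij) // -ltnS.
have [v0 _] : exists v0 : 'I_n, true.
  by case: (enum Z) iZ => [|v0 ?] //; exists v0.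
pose v := nth v0 (enum Z) i.
move=> /(_ (\pi_{ideal_quot I} 'X_v)); rewrite !pE !restrictX.
have dE : drop i (enum Z) = v :: drop i.+1 (enum Z) by rewrite -drop_nth.
have suppv k : supp_in (V k) U_(v) = (v \in V k).
  apply/forallP/idP => [/(_ v)|vV u]; first by rewrite mnm1E eqxx.
  by rewrite mnm1E; case: eqP => // <-.
have vi : v \in V i by rewrite inE dE inE eqxx.
have vj : v \notin V j.
  rewrite inE; have : uniq (drop i (enum Z)) by rewrite drop_uniq ?enum_uniq.
  rewrite dE /= => /andP[vi1 _]; apply: contra vi1.
  by rewrite -(subnK ij) -drop_drop; apply: mem_drop.
rewrite !suppv vi (negPf vj) eqxx => /(_ isT).
by rewrite -msupp_eq0 msuppX.
Qed.

Definition free_vars I : {set 'I_n} :=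
  [set i | `[< forall k, 'X_i ^+ k \notin (I : {pred S}) >]].

Lemma mem_free_vars I i k : i \in free_vars I -> 'X_[U_(i) *+ k] \notin I.
Proof. by rewrite inE -mpolyXn => /asboolP. Qed.

(** Primarity cancels from a monomial of [I] every power of a free variable, so
    that a monomial in free variables only would put 1 in [I]. *)
Lemma primary_supp_free_vars I m :
  primary_ideal I -> 'X_[m] \in I -> ~~ supp_in (free_vars I) m.
Proof.
move=> Iprim mI; apply/negP => /forallP mfree; move: mI.
rewrite mpolyXE_id; apply/negP; elim: (index_enum _) => [|i s IHs].
  by rewrite big_nil idealr1.
rewrite big_cons mulrC; apply/negP => /Iprim[|[k]]; first exact/negP.
rewrite -exprM; have := mfree i; case: posnP => [->|_ /=].
  by rewrite expr0 idealr1.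
by rewrite inE => /asboolP/(_ (m i * k)%N)/negP.
Qed.

(** A common free variable would give a positive-dimensional quotient: no
    monomial of [I] or of [J] is supported on the common free variables. *)
Lemma free_vars_disjoint I J :
  primary_ideal I -> primary_ideal J ->
  krull_dim {ideal_quot (ideal_sum I J)} 0 ->
  [disjoint free_vars I & free_vars J].
Proof.
move=> Iprim Jprim dim0; rewrite -setI_eq0 -cards_eq0 -leqn0.
apply: (krull_dim_ge_card _ dim0) => m /ideal_sumP[f [h [fI hJ mE]]].
have : m \in msupp (f + h) by rewrite -mE msuppX inE.
move=> /msuppD_le; rewrite mem_cat => /orP[mf|mh].
  apply: contra (primary_supp_free_vars Iprim (monomial_msupp fI mf)).
  exact/supp_inS/subsetIl.
apply: contra (primary_supp_free_vars Jprim (monomial_msupp hJ mh)).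
exact/supp_inS/subsetIr.
Qed.

Lemma not_subset_monomial I J :
  ~ {subset J <= I} -> exists2 m, 'X_[m] \in J & 'X_[m] \notin I.
Proof.
move=> JI; apply/not_exists2P => H; apply: JI => f fJ.
rewrite [f]mpolyE big_seq; apply: rpred_sum => m mf.
rewrite -mul_mpolyC idealMr //.
by have [/(_ (monomial_msupp fJ mf))|/negP/negPn] := H m.
Qed.

Lemma mpolyX_idealD I m w : 'X_[m] \in I -> 'X_[m + w] \in I.
Proof. by move=> mI; rewrite mpolyXD mulrC idealMr. Qed.

Lemma common_power I :
  exists N, forall i, i \notin free_vars I -> 'X_[U_(i) *+ N] \in I.
Proof.
have /choice[k kP] i : exists k, i \notin free_vars I -> 'X_[U_(i) *+ k] \in I.
  case: (pselect (exists k, 'X_[U_(i) *+ k] \in I)) => [[k ?]|no]; first by exists k.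
  exists 0%N; rewrite inE => /asboolP[] k; apply/negP; rewrite mpolyXn => kI.
  by apply: no; exists k.
exists (\max_i k i)%N => i /kP iI.
by rewrite -(subnKC (leq_bigmax i)) -mpolyXn exprD mpolyXn mulrC idealMr.
Qed.

(** * Stanley decompositions as partitions of monomials *)

(** The combinatorial shadow of a Stanley decomposition of the quotient by the
    monomial ideal with set of monomials [L]. *)
Definition monomial_partition (r : nat) (L : pred 'X_{1..n})
    (g : 'I_r -> 'X_{1..n}) (Z : 'I_r -> {set 'I_n}) : Prop :=
  [/\ forall i w, supp_in (Z i) w -> ~~ L (g i + w)%MM,
      forall m, ~~ L m -> exists i w, supp_in (Z i) w /\ m = (g i + w)%MM
    & forall i j w w', supp_in (Z i) w -> supp_in (Z j) w' ->
        (g i + w = g j + w')%MM -> i = j].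

(** A nonzero homogeneous element is the class of a scalar multiple of a single
    monomial, since distinct monomials have distinct multidegrees.  Freeness then
    keeps each block outside [I], spanning makes the blocks cover, and uniqueness
    of the decomposition of the class of a monomial makes them disjoint. *)
Lemma stanley_partition I (D : stanley_decomposition {ideal_quot I}) :
  exists g : 'I_(sd_size D) -> 'X_{1..n},
    monomial_partition (fun m => 'X_[m] \in I) g (@sd_vars _ _ _ D).
Proof.
have mon1 Z : (1 : S) \in polys_in Z.
  by rewrite inE msupp1 /= andbT; apply/forallP => i; rewrite mnm0E.
have monX Z c w : supp_in Z w -> (c *: 'X_[w] : S) \in polys_in Z.
  move=> wZ; rewrite inE; apply/allP => k /msuppZ_le.
  by rewrite msuppX inE => /eqP ->.
have /choice[cg cgP] (i : 'I_(sd_size D)) : exists cg : K * 'X_{1..n},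
    cg.1 != 0 /\ sd_elt i = \pi_{ideal_quot I} (cg.1 *: 'X_[cg.2]).
  have [a [f [fa zE]]] := @sd_homogeneous _ _ _ D i.
  case fE: (msupp f) => [|m s].
    have /eqP := fE; rewrite msupp_eq0 => /eqP f0.
    have := @sd_free _ _ _ D i 1 (mon1 _); rewrite scale1r zE f0 rmorph0.
    by move=> /(_ erefl)/eqP; rewrite oner_eq0.
  exists (f@_m, m); split; first by rewrite -mcoeff_msupp fE inE eqxx.
  rewrite zE /=; congr (\pi_{ideal_quot I} _).
  apply/mpolyP => k; rewrite mcoeffZ mcoeffX; case: eqVneq => [->|mk].
    by rewrite mulr1.
  rewrite mulr0; apply: memN_msupp_eq0; apply: contra mk => kf.
  by apply/eqP/mdegree_inj; rewrite (fa k kf) (fa m) // fE inE eqxx.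
have nonzero (i : 'I_(sd_size D)) w :
    supp_in (sd_vars i) w -> 'X_[(cg i).2 + w] \notin I.
  move=> wZ; apply/negP => giw.
  have := @sd_free _ _ _ D i (1 *: 'X_[w]) (monX _ _ _ wZ); rewrite scale1r.
  rewrite (cgP i).2 quot_scaleE -scalerAr -mpolyXD addmC -mul_mpolyC.
  move=> H; have /eqP : 'X_[w] = 0 :> S.
    by apply: H; apply/eqP; rewrite pi_eq0 idealMr.
  by rewrite -msupp_eq0 msuppX.
exists (fun i => (cg i).2); split=> //.
- move=> m mI.
  have [u [[uZ mE] _]] := @sd_direct _ _ _ D (\pi_{ideal_quot I} 'X_[m]).
  have /choice[f fP] i : exists f : S, f \in polys_in (sd_vars i) /\
      u i = \pi_{ideal_quot I} (f * ((cg i).1 *: 'X_[(cg i).2])).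
    by have [f fZ uE] := uZ i; exists f; rewrite uE (cgP i).2 quot_scaleE.
  (* A monomial ideal contains all monomials of its elements, so [m], which is
     not in [I], must cancel against a monomial of [h]. *)
  pose h := \sum_i f i * ((cg i).1 *: 'X_[(cg i).2]).
  have hI : 'X_[m] - h \in I.
    rewrite -pi_eq0 rmorphB subr_eq0 [X in X == _]mE rmorph_sum; apply/eqP.
    by apply: eq_bigr => i _; rewrite (fP i).2.
  have : m \in msupp h.
    apply: contraNT mI => mh; apply: monomial_msupp hI _.
    by rewrite mcoeff_msupp mcoeffB mcoeffX eqxx (memN_msupp_eq0 mh) subr0 oner_eq0.
  rewrite mcoeff_msupp /h raddf_sum /= => /eqP sum0.
  have [i fi0] : exists i, (f i * ((cg i).1 *: 'X_[(cg i).2]))@_m != 0.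
    apply/existsP; apply: contra_notT sum0; rewrite negb_exists => /forallP f0.
    by apply: big1 => i _; apply/eqP; have := f0 i; rewrite negbK.
  move: fi0; rewrite -mcoeff_msupp -scalerAr => /msuppZ_le.
  rewrite (perm_mem (msuppMX _ _)) => /mapP[w wf ->].
  exists i, w; split=> //.
  by have := (fP i).1; rewrite inE => /allP/(_ w wf).
- move=> i j w w' wZ wZ' gE; apply/eqP; apply/negPn/negP => ij.
  set m := ((cg i).2 + w)%MM in gE.
  have [u [_ uniq_u]] := @sd_direct _ _ _ D (\pi_{ideal_quot I} 'X_[m]).
  (* If [m] lies in the blocks [i] and [j], its class is a sum of elements of the
     Stanley spaces both with all terms but the i-th zero and with all terms but
     the j-th zero. *)
  pose one_at (k : 'I_(sd_size D)) : {ffun 'I_(sd_size D) -> {ideal_quot I}} :=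
    [ffun l => if l == k then \pi_{ideal_quot I} 'X_[m] else 0].
  have one_atP (k : 'I_(sd_size D)) v :
      supp_in (sd_vars k) v -> m = ((cg k).2 + v)%MM -> u = one_at k.
    move=> vZ mE; apply: uniq_u; split=> [l|].
      rewrite ffunE; case: eqP => [->|_]; last first.
        by exists 0; rewrite ?scale0r // inE msupp0.
      exists ((cg k).1^-1 *: 'X_[v]); first exact: monX.
      rewrite (cgP k).2 quot_scaleE -scalerAl -scalerAr scalerA mulVf ?(cgP k).1 //.
      by rewrite scale1r -mpolyXD addmC -mE.
    rewrite (bigD1 k) //= ffunE eqxx big1 ?addr0 // => l /negPf lk.
    by rewrite ffunE lk.
  have := one_atP i w wZ erefl; rewrite (one_atP j w' wZ' gE) => /ffunP/(_ i).
  rewrite !ffunE eqxx (negPf ij) => /esym/eqP; rewrite pi_eq0.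
  by apply/negP/nonzero.
Qed.

Lemma sdepth_decomposition_le (M : multigradedType K n)
    (D : stanley_decomposition M) (i : 'I_(sd_size D)) :
  (sdepth_decomposition D <= #|sd_vars i|)%N.
Proof.
rewrite /sdepth_decomposition; have := mem_index_enum i.
elim: (index_enum _) => // j s IHs; rewrite inE big_cons geq_min.
by case/predU1P => [->|/IHs ->]; rewrite ?leqnn ?orbT.
Qed.

(** * Partitions for the intersection of two ideals *)

Section PartitionOfIntersection.
Variables (I J : monomial_ideal K n) (r : nat).
Variables (g : 'I_r -> 'X_{1..n}) (Z : 'I_r -> {set 'I_n}).
Hypothesis gZ :
  monomial_partition (fun m => ('X_[m] \in I) && ('X_[m] \in J)) g Z.

(** The block of [m] works: multiplying [m] by powers of a variable of the block
    remains in [J], hence must avoid [I]. *)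
Lemma partition_sub_free_vars m :
  'X_[m] \in J -> 'X_[m] \notin I -> exists i, Z i \subset free_vars I.
Proof.
case: gZ => ZL Lcov _ mJ mI.
have [|i [w [wZ mE]]] := Lcov m; first by rewrite negb_and mI.
exists i; apply/subsetP => j jZ; rewrite inE; apply/asboolP => k.
have := ZL _ _ (supp_inD k wZ jZ); rewrite addmA -mE (mpolyX_idealD _ mJ) andbT.
by apply: contra; rewrite mpolyXn addmC; apply: mpolyX_idealD.
Qed.

(** Were there variables [j] outside [free_vars I] and [k] outside [free_vars J]
    in the block of 1, it would contain [x_j ^ N * x_k ^ N'], which lies in
    [I :&: J] for large [N] and [N']. *)
Lemma block_of_one :
  exists i, g i = 0%MM /\ (Z i \subset free_vars I \/ Z i \subset free_vars J).
Proof.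
case: gZ => ZL Lcov _.
have [|i [w [wZ /esym/eqP]]] := Lcov 0%MM; first by rewrite mpolyX0 idealr1.
rewrite mnmD_eq0 => /andP[/eqP gi0 _]; exists i; split=> //.
have [N NI] := common_power I; have [N' NJ] := common_power J.
case: (boolP (Z i \subset free_vars I)) => [|/subsetPn[j jZ jI]]; first by left.
right; apply/subsetP => k kZ; apply/negPn/negP => kJ.
have z0 : supp_in (Z i) 0%MM by apply/forallP => l; rewrite mnm0E.
have := ZL _ _ (supp_inD N' (supp_inD N z0 jZ) kZ).
rewrite gi0 !add0m (mpolyX_idealD _ (NI _ jI)) /= addmC.
by rewrite mpolyX_idealD ?NJ.
Qed.

(** The blocks of the powers [x_j ^ N], for [x_j] in [free_vars J], define an
    oriented graph on [free_vars J] with all out-degrees at least [s.-1].  The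
    assumption on the block of 1 is what separates these blocks: a generator
    dividing powers of two variables is 1. *)
Lemma partition_uphalf i0 s :
  [disjoint free_vars I & free_vars J] ->
  g i0 = 0%MM -> Z i0 \subset free_vars I ->
  (forall i, s <= #|Z i|)%N -> (0 < s)%N -> (0 < #|free_vars J|)%N ->
  (s <= uphalf #|free_vars J|)%N.
Proof.
move=> dIJ gi0 Zi0 sZ s0 Y0; case: gZ => ZL Lcov Linj.
have [N NI] := common_power I.
pose p (j : 'I_n) : 'X_{1..n} := (U_(j) *+ N)%MM.
have pI j : j \in free_vars J -> 'X_[p j] \in I.
  by move=> jJ; apply: NI; rewrite (disjointFl dIJ).
have /choice[c cP] j : exists i, j \in free_vars J ->
    exists w, supp_in (Z i) w /\ p j = (g i + w)%MM.
  have [jJ|_] := boolP (j \in free_vars J); last by exists i0.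
  have [|i [w [wZ pE]]] := Lcov (p j); last by exists i => _; exists w.
  by rewrite negb_and (mem_free_vars N jJ) orbT.
have supp0 V : supp_in V 0%MM by apply/forallP => l; rewrite mnm0E.
(* [p j] is in [I], so powers of the variables of its block avoid [J]. *)
have cZ j : j \in free_vars J -> Z (c j) \subset free_vars J.
  move=> jJ; have [w [wZ pE]] := cP j jJ; apply/subsetP => k kZ.
  rewrite inE; apply/asboolP => l.
  have := ZL _ _ (supp_inD l wZ kZ); rewrite addmA -pE.
  rewrite (mpolyX_idealD _ (pI _ jJ)) /=.
  by apply: contra; rewrite mpolyXn addmC; apply: mpolyX_idealD.
have c_neq j : j \in free_vars J -> c j != i0.
  move=> jJ; apply/eqP => cj; have := cZ j jJ; rewrite cj => Zi0J.
  have /card_gt0P[k kZ] := leq_trans s0 (sZ i0).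
  by have := disjointFr dIJ (subsetP Zi0 _ kZ); rewrite (subsetP Zi0J).
(* A block met by powers of two variables is generated by 1. *)
have c_inj : {in free_vars J &, injective c}.
  move=> j k jJ kJ cjk; apply/eqP/negPn/negP => jk.
  have [w [wZ pj]] := cP j jJ; have [w' [wZ' pk]] := cP k kJ.
  have := c_neq j jJ; rewrite (@Linj (c j) i0 0%MM 0%MM) ?eqxx // gi0 addm0.
  apply/mnmP => l; rewrite addm0 mnm0E.
  have /mnmP/(_ l) := pj; have /mnmP/(_ l) := pk; rewrite -cjk.
  rewrite !mnmDE !mulmnE !mnm1E.
  case: (eqVneq j l) jk => [<-|_ _]; last first.
    by move=> _; rewrite mul0n => /esym/eqP; rewrite addn_eq0 => /andP[/eqP].
  rewrite eq_sym => /negPf->; rewrite mul0n => /esym/eqP.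
  by rewrite addn_eq0 => /andP[/eqP].
pose arrow : rel 'I_n := fun j k => (j != k) && (k \in Z (c j)).
have sY : (s.-1.*2 < #|free_vars J|)%N.
  apply: (@oriented_graph_outdegree _ _ arrow) => //.
  - by move=> j; rewrite /arrow eqxx.
  (* With both arrows, [p j + p k] would lie in both blocks. *)
  - move=> j k jJ kJ /andP[jk kZ]; apply/negP => /andP[_ jZ].
    have [w [wZ pj]] := cP j jJ; have [w' [wZ' pk]] := cP k kJ.
    case/eqP: jk; apply: c_inj => //.
    apply: (Linj _ _ _ _ (supp_inD N wZ kZ) (supp_inD N wZ' jZ)).
    by rewrite !addmA -pj -pk addmC.
  - move=> j jJ; apply: (@leq_trans #|Z (c j) :\ j|).
      rewrite -ltnS prednK // (leq_trans (sZ (c j))) // (cardsD1 j) -add1n leq_add2r.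
      exact: leq_b1.
    apply/subset_leq_card/subsetP => k; rewrite in_setD1 in_set => /andP[kj kZ].
    by rewrite (subsetP (cZ j jJ)) //= /arrow eq_sym kj.
by rewrite -(prednK s0) geq_uphalf_double doubleS.
Qed.

End PartitionOfIntersection.

End MonomialIdeals.

(** * The bound on the Stanley depth *)

Theorem proposition2p2 (K : fieldType) (n : nat)
    (Q Q' : monomial_ideal K n)
    (hQ0 : exists2 f : {mpoly K[n]}, f \in Q & f != 0)
    (hQ'0 : exists2 f : {mpoly K[n]}, f \in Q' & f != 0)
    (hQ : primary_ideal Q) (hQ' : primary_ideal Q')
    (P P' : prime_idealr {mpoly K[n]})
    (hP : associated_prime {ideal_quot Q} P)
    (hP' : associated_prime {ideal_quot Q'} P')
    (hPP' : ~ (P =i P'))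
    (hQQ' : ~ {subset Q <= Q'}) (hQ'Q : ~ {subset Q' <= Q})
    (hsum : krull_dim {ideal_quot (ideal_sum Q Q')} 0)
    (d d' : nat)
    (hd : krull_dim {ideal_quot Q} d)
    (hd' : krull_dim {ideal_quot Q'} d') :
  (sdepth {ideal_quot (ideal_cap Q Q')}
     <= maxn (minn d' (uphalf d)) (minn d (uphalf d')))%N.
Proof.
apply/bigmax_leqP => -[s _] /asboolP[D /= <-].
set t := sdepth_decomposition D.
have [->//|t0] := posnP t.
have tZ : forall i, (t <= #|sd_vars i|)%N := @sdepth_decomposition_le _ _ _ D.
have [g gZ] := stanley_partition D.
have gZ' : monomial_partition (fun m => ('X_[m] \in Q') && ('X_[m] \in Q)) g
    (@sd_vars _ _ _ D).
  case: gZ => gZ1 gZ2 gZ3; split=> //= [i w|m]; rewrite andbC.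
    exact: gZ1.
  exact: gZ2.
have dimX := krull_dim_ge_card (fun m => primary_supp_free_vars hQ) hd.
have dimY := krull_dim_ge_card (fun m => primary_supp_free_vars hQ') hd'.
have dXY := free_vars_disjoint hQ hQ' hsum.
have tX : (t <= #|free_vars Q|)%N.
  have [m mQ' mQ] := not_subset_monomial hQ'Q.
  have [i /subset_leq_card] := partition_sub_free_vars gZ mQ' mQ.
  exact: leq_trans (tZ i).
have tY : (t <= #|free_vars Q'|)%N.
  have [m mQ mQ'] := not_subset_monomial hQQ'.
  have [i /subset_leq_card] := partition_sub_free_vars gZ' mQ mQ'.
  exact: leq_trans (tZ i).
have [i0 [gi0 [Zi0|Zi0]]] := block_of_one gZ.
  have tY2 := partition_uphalf gZ dXY gi0 Zi0 tZ t0 (leq_trans t0 tY).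
  rewrite leq_max orbC leq_min (leq_trans tX dimX).
  by rewrite (leq_trans tY2) ?uphalf_leq.
have dYX : [disjoint free_vars Q' & free_vars Q] by rewrite disjoint_sym.
have tX2 := partition_uphalf gZ' dYX gi0 Zi0 tZ t0 (leq_trans t0 tX).
rewrite leq_max leq_min (leq_trans tY dimY).
by rewrite (leq_trans tX2) ?uphalf_leq.
Qed.
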